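(* Suppose $(X,\rho)$ is a quasi-metric space and $\mu$ is a positive Borel measure on $X$ with the doubling property. Let $\mathscr{D}^t$, $t=1,\ldots,K$, be the adjacent dyadic systems described in the context. There exist constants $C>0$ and $C'>0$ depending only on $X$ and $\mu$ such that for every $f\in L^1_{\mathrm{loc}}(X,\mu)$, $$C\,\|f\|_{\mathrm{BMO}_{\mathscr{D}^t}}\le\|f\|_{\mathrm{BMO}}\le C'\sum_{t=1}^K\|f\|_{\mathrm{BMO}_{\mathscr{D}^t}},$$ where the first estimate holds for every $t=1,\ldots,K$. Thus $$\mathrm{BMO}(\mu)=\bigcap_{t=1}^K\mathrm{BMO}_{\mathscr{D}^t}(\mu)$$ with equivalent norms.
   Context: A quasi-metric $\rho$ on $X$ satisfies the axioms of a metric except that the triangle inequality is weakened to $\rho(x,y)\le A_0(\rho(x,z)+\rho(z,y))$ with $A_0\ge1$. Balls are $B(x,r):=\{y\in X:\rho(y,x)<r\}$, $r>0$; $2B$ is the ball with the same centre and twice the radius. The topology consists of the sets $U$ such that each $x\in U$ has some $B(x,\varepsilon)\subseteq U$. Doubling property: $\mu(2B)\le C\mu(B)$ for all balls $B$ with a constant independent of $B$; balls are taken to be measurable and $0<\mu(B)<\infty$ for all balls. $L^1_{\mathrm{loc}}(X,\mu)$ is the set of measurable functions integrable on balls. Adjacent dyadic systems (fixed; such systems exist): $\delta\in(0,1)$ is fixed with $96A_0^6\delta\le1$, $c_1:=(12A_0^4)^{-1}$, $C_1:=4A_0^2$, and each $\mathscr{D}^t=\{Q^k_\alpha\}_{k\in\mathbb{Z},\alpha\in\mathscr{A}_k}$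 is a family of Borel sets (half-open dyadic cubes) with centre points $z^k_\alpha$ (depending on $t$) such that: if $\ell\ge k$, then either $Q^\ell_\beta\subseteq Q^k_\alpha$ or $Q^\ell_\beta\cap Q^k_\alpha=\varnothing$; $X=\bigcup_\alpha Q^k_\alpha$ (disjoint union) for every $k$; $B(z^k_\alpha,c_1\delta^k)\subseteq Q^k_\alpha\subseteq B(z^k_\alpha,C_1\delta^k)=:B(Q^k_\alpha)$; if $k\le\ell$ and $Q^\ell_\beta\subseteq Q^k_\alpha$ then $B(Q^\ell_\beta)\subseteq B(Q^k_\alpha)$. Moreover there is a constant $C$ depending only on $A_0,\delta$ such that for every ball $B(x,r)$ there exist $t$ and $Q\in\mathscr{D}^t$ with $B(x,r)\subseteq Q$ and $\operatorname{diam}(Q)\le Cr$. For a bounded measurable set $E$ with $\mu(E)>0$, $f_E:=\frac1{\mu(E)}\int_Ef\,d\mu$. Define $$\|f\|_{\mathrm{BMO}}:=\sup_B\frac1{\mu(B)}\int_B|f-f_B|\,d\mu,\qquad\|f\|_{\mathrm{BMO}_{\mathscr{D}^t}}:=\sup_{Q\in\mathscr{D}^t}\frac1{\mu(Q)}\int_Q|f-f_Q|\,d\mu,$$ suprema over all balls and over all cubes of $\mathscr{D}^t$, respectively (values in $[0,\infty]$). $\mathrm{BMO}(\mu)$ and $\mathrm{BMO}_{\mathscr{D}^t}(\mu)$ are the sets of $f\in L^1_{\mathrm{loc}}(X,\mu)$, modulo additive constants, for which the respective quantity is finite. *)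

(* Defs.v *)
From HB Require Import structures.
From mathcomp Require Import all_boot all_order all_algebra.
From mathcomp Require Import all_classical all_reals all_analysis.

Set Implicit Arguments.
Unset Strict Implicit.
Unset Printing Implicit Defensive.

Import Order.TTheory GRing.Theory Num.Theory.
Import numFieldNormedType.Exports.

Local Open Scope classical_set_scope.
Local Open Scope ring_scope.

Section QuasiMetric.
Context {R : realType} {X : Type}.
Implicit Types (rho : X -> X -> R).

Definition quasi_metric rho (A0 : R) : Prop :=
  [/\ 1 <= A0,
      forall x y, 0 <= rho x y,
      forall x y, rho x y = 0 <-> x = y,
      forall x y, rho x y = rho y x
    & forall x y z, rho x y <= A0 * (rho x z + rho z y)].

Definition qball rho (x : X) (r : R) : set X := [set y | rho y x < r].

Definition qballs rho : set (set X) :=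
  [set B | exists x r, 0 < r /\ B = qball rho x r].

Definition qopen rho : set (set X) :=
  [set U | forall x, U x -> exists2 e, 0 < e & qball rho x e `<=` U].

Definition qborel rho : set (set X) := <<s qopen rho >>.

(* The supremum lives in the extended reals, so unbounded sets have diameter
   +oo; it is only used for nonempty sets. *)
Definition qdiam rho (E : set X) : \bar R :=
  ereal_sup [set (rho p.1 p.2)%:E | p in E `*` E].

End QuasiMetric.

Record dyadic_system (X : Type) := DyadicSystem {
  dindex : int -> Type;
  dcube : forall k : int, dindex k -> set X;
  dcenter : forall k : int, dindex k -> X
}.

Section DyadicSystems.
Context {R : realType} {X : Type}.
Implicit Types (rho : X -> X -> R) (D : dyadic_system X).

Definition dcubes D : set (set X) :=
  [set Q | exists (k : int) (a : dindex D k), Q = dcube a].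

Definition inner_const (A0 : R) : R := (12%:R * A0 ^+ 4)^-1.
Definition outer_const (A0 : R) : R := 4%:R * A0 ^+ 2.

(* B(Q) depends on the label (k, alpha) of the cube, not only on the set Q. *)
Definition dball rho (A0 delta : R) D (k : int) (a : dindex D k) : set X :=
  qball rho (dcenter a) (outer_const A0 * delta ^ k).

Definition is_dyadic_system rho (A0 delta : R) D : Prop :=
  [/\ forall (k : int) (a : dindex D k), qborel rho (dcube a),
      forall (k l : int) (a : dindex D k) (b : dindex D l), k <= l ->
        dcube b `<=` dcube a \/ dcube b `&` dcube a = set0,
      forall k : int, trivIset setT (@dcube X D k) /\
        \bigcup_(a in [set: dindex D k]) dcube a = setT,
      forall (k : int) (a : dindex D k),
        qball rho (dcenter a) (inner_const A0 * delta ^ k) `<=` dcube a /\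
        dcube a `<=` dball rho A0 delta a
    & forall (k l : int) (a : dindex D k) (b : dindex D l), k <= l ->
        dcube b `<=` dcube a -> dball rho A0 delta b `<=` dball rho A0 delta a].

(* c is the constant with diam Q <= c r, which depends on A0 and delta only. *)
Definition adjacent_dyadic_systems rho (A0 delta c : R) (K : nat)
    (D : 'I_K -> dyadic_system X) : Prop :=
  (forall t, is_dyadic_system rho A0 delta (D t)) /\
  (forall (x : X) (r : R), 0 < r ->
     exists t, exists Q, [/\ dcubes (D t) Q,
       qball rho x r `<=` Q & (qdiam rho Q <= (c * r)%:E)%E]).

End DyadicSystems.

Section BMO.
Context {R : realType} {d : measure_display} {X : measurableType d}.
Variables (rho : X -> X -> R) (mu : {measure set X -> \bar R}).
Implicit Types (f g : X -> R) (E : set X) (S : set (set X)).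

(* The sigma-algebra on which mu is defined contains the Borel sets of the
   quasi-metric topology. Balls need not be Borel for a quasi-metric, so their
   measurability is a separate requirement below. *)
Definition borel_sets_measurable : Prop := qborel rho `<=` measurable.

Definition doubling_measure : Prop :=
  [/\ forall x r, 0 < r -> measurable (qball rho x r),
      forall x r, 0 < r -> (0 < mu (qball rho x r) < +oo)%E
    & exists Cd : R, forall x r, 0 < r ->
        (mu (qball rho x (2%:R * r)) <= Cd%:E * mu (qball rho x r))%E].

Definition L1loc : set (X -> R) :=
  [set f | measurable_fun setT f /\
    forall x r, 0 < r -> mu.-integrable (qball rho x r) (EFin \o f)].

Definition average f E : R := (fine (mu E))^-1 * \int[mu]_(x in E) f x.

Definition mean_oscillation f E : \bar R :=
  (((fine (mu E))^-1)%R%:E * \int[mu]_(x in E) `|f x - average f E|%:E)%E.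

(* Since the carrier of a measurableType is inhabited, there are always balls
   and dyadic cubes, so that these suprema lie in [0, +oo]. *)
Definition bmo_norm S f : \bar R :=
  ereal_sup [set mean_oscillation f E | E in S].

Definition BMO_norm f : \bar R := bmo_norm (qballs rho) f.

Definition BMOD_norm (D : dyadic_system X) f : \bar R := bmo_norm (dcubes D) f.

(* Functions of L1loc are identified when they agree almost everywhere up to
   an additive constant, so that the seminorms above become norms. *)
Definition mod_const f : set (X -> R) :=
  [set g | L1loc g /\ exists c : R, \forall x \ae mu, g x = f x + c].

Definition BMO : set (set (X -> R)) :=
  [set mod_const f | f in [set f | L1loc f /\ (BMO_norm f < +oo)%E]].

Definition BMOD (D : dyadic_system X) : set (set (X -> R)) :=
  [set mod_const f | f in [set f | L1loc f /\ (BMOD_norm D f < +oo)%E]].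

End BMO.

(* Main.v *)
Require Import Defs.
From HB Require Import structures.
From mathcomp Require Import all_boot all_order all_algebra.
From mathcomp Require Import all_classical all_reals all_analysis.
From mathcomp Require Import measurable_realfun.

Set Implicit Arguments.
Unset Strict Implicit.
Unset Printing Implicit Defensive.

Import Order.TTheory GRing.Theory Num.Theory.
Import numFieldNormedType.Exports.

Local Open Scope classical_set_scope.
Local Open Scope ring_scope.

(** The mean oscillation of [f] over [E] is, up to a factor 2, the mean distance
    of [f] to any constant over [E] ([oscillation_le_center]).  Taking as
    constant the average of [f] over a larger set [F] whose measure is at most
    [M] times that of [E], the oscillation over [E] is at most [2 * M] times
    the oscillation over [F] ([oscillation_le_super]).  Both estimates between
    the norms come from this comparison, the constants [M] being supplied by
    doubling ([doubling_dilation]).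

    - A dyadic cube lies between two concentric balls whose radii have a fixed
      ratio; its outer ball therefore has comparable measure, and bounds its
      oscillation ([BMOD_norm_le]).
    - A ball of radius [r] lies in a cube, of one of the adjacent systems, whose
      diameter is at most [c * r].  That cube lies in a fixed dilate of the
      ball, so it has comparable measure and bounds the oscillation over the
      ball ([ball_oscillation_le_cube]).  As the system depends on the ball, it
      is the sum over all systems that bounds the full norm
      ([BMO_norm_le_sum]).

    For the equality of the spaces, a class that belongs to every dyadic space
    may be represented by a different function in each of them.  These
    representatives agree almost everywhere up to a constant, which leaves
    every oscillation unchanged ([oscillation_ae_const]), so that one
    representative has finite norm in all the systems at once. *)

(** * Comparison of mean oscillations over nested sets *)

Section Oscillation.
Context {R : realType} {d : measure_display} {X : measurableType d}.
Variable mu : {measure set X -> \bar R}.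
Implicit Types (f g : X -> R) (E F : set X) (S : set (set X)).

Definition averageable f E : Prop :=
  [/\ measurable E, (0 < mu E < +oo)%E & mu.-integrable E (EFin \o f)].

Lemma fine_measure_gt0 f E : averageable f E -> 0 < fine (mu E).
Proof. by move=> [_ /andP[? ?] _]; rewrite fine_gt0 //; apply/andP. Qed.

Lemma measure_fineE f E : averageable f E -> mu E = (fine (mu E))%:E.
Proof. by move=> [_ /andP[h h'] _]; rewrite fineK// ge0_fin_numE. Qed.

Lemma averageableS f E F : averageable f F -> measurable E ->
  (0 < mu E)%E -> E `<=` F -> averageable f E.
Proof.
move=> [mF /andP[_ Foo] iF] mE E0 EF; split=> //; last exact: integrableS iF.
by rewrite E0 /=; apply: le_lt_trans Foo; apply: le_measure => //; rewrite inE.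
Qed.

Lemma integrable_constant E (k : R) : measurable E -> (mu E < +oo)%E ->
  mu.-integrable E (EFin \o cst k).
Proof.
move=> mE Eoo; apply/integrableP; split; first exact/measurable_EFinP.
rewrite (_ : (fun x => _) = cst `|k%:E|%E)// integral_cst//.
by rewrite lte_mul_pinfty.
Qed.

Lemma integrable_subr f E (a : R) : averageable f E ->
  mu.-integrable E (EFin \o (fun x => f x - a)).
Proof.
move=> [mE /andP[_ Eoo] iE].
have -> : EFin \o (fun x => f x - a) = ((EFin \o f) \- (EFin \o cst a))%E by [].
by apply: integrableB => //; exact: integrable_constant.
Qed.

Lemma integral_norm_fineE f E (a : R) : averageable f E ->
  (\int[mu]_(x in E) `|f x - a|%:E = (\int[mu]_(x in E) `|f x - a|)%:E)%E.
Proof.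
move=> aE; rewrite /Rintegral fineK//; apply: integrable_fin_num.
  by case: aE.
exact: (integrable_norm (integrable_subr a aE)).
Qed.

(** This is the triangle inequality for integrals, applied to [f - a], whose
    integral is the measure of [E] times the difference between the average
    of [f] and [a]. *)
Lemma average_dist_le f E (a : R) : averageable f E ->
  fine (mu E) * `|a - average mu f E| <= \int[mu]_(x in E) `|f x - a|.
Proof.
move=> aE; have m0 := fine_measure_gt0 aE; have [mE /andP[_ Eoo] iE] := aE.
apply: le_trans (le_normr_Rintegral mE (integrable_subr a aE)).
rewrite RintegralB ?Rintegral_cst//; last exact: integrable_constant.
rewrite -[X in X * _ <= _](gtr0_norm m0) -normrM mulrBr mulrA.
by rewrite mulfV ?gt_eqF// mul1r distrC [a * _]mulrC.
Qed.

(** The average is, up to a factor 2, the best constant approximation of [f] in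
    mean: replacing it by [a] costs the distance between the two, which
    [average_dist_le] bounds by the mean distance of [f] to [a]. *)
Lemma oscillation_le_center f E (a : R) : averageable f E ->
  (mean_oscillation mu f E <=
   ((fine (mu E))^-1 * (2 * \int[mu]_(x in E) `|f x - a|))%:E)%E.
Proof.
move=> aE; have m0 := fine_measure_gt0 aE; have [mE /andP[_ Eoo] iE] := aE.
rewrite /mean_oscillation integral_norm_fineE// -EFinM lee_fin.
rewrite ler_pM2l ?invr_gt0//.
have ia := integrable_norm (integrable_subr a aE).
have ic := integrable_constant `|a - average mu f E| mE Eoo.
apply: (@le_trans _ _
  (\int[mu]_(x in E) (`|f x - a| + `|a - average mu f E|))).
  apply: le_Rintegral => //.
  - exact: (integrable_norm (integrable_subr _ aE)).
  - exact: (integrableD mE ia ic).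
  - by move=> x _; rewrite (le_trans _ (ler_normD _ _))// addrA subrK.
rewrite RintegralD// Rintegral_cst// mulr2n mulrDl mul1r lerD2l mulrC.
exact: average_dist_le.
Qed.

(** Centre both oscillations at the average over [F]: the integral then only
    grows from [E] to [F], and the normalizing factors differ by at most
    [M]. *)
Lemma oscillation_le_super f E F (M : R) : averageable f F -> measurable E ->
  (0 < mu E)%E -> E `<=` F -> (mu F <= M%:E * mu E)%E ->
  (mean_oscillation mu f E <= (2 * M)%:E * mean_oscillation mu f F)%E.
Proof.
move=> aF mE E0 EF; have aE := averageableS aF mE E0 EF.
have [mF _ _] := aF.
have mE0 := fine_measure_gt0 aE; have mF0 := fine_measure_gt0 aF.
rewrite (measure_fineE aF) (measure_fineE aE) -EFinM lee_fin => FE.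
apply: le_trans (oscillation_le_center (average mu f F) aE) _.
rewrite /mean_oscillation integral_norm_fineE// -!EFinM lee_fin.
set I := Rintegral mu E _; set J := Rintegral mu F _.
have I0 : 0 <= I by apply: Rintegral_ge0.
have IJ : I <= J.
  rewrite -lee_fin /I /J -!integral_norm_fineE//.
  apply: ge0_subset_integral => //.
  exact: (measurable_int mu (integrable_norm (integrable_subr _ aF))).
rewrite mulrCA -mulrA ler_pM2l//.
apply: (@le_trans _ _ (M / fine (mu F) * I)); last first.
  rewrite -mulrA ler_wpM2l//; last by rewrite ler_wpM2l// invr_ge0 ltW.
  by rewrite -(pmulr_lge0 _ mE0) (le_trans _ FE)// ltW.
by apply: ler_wpM2r => //; rewrite ler_pdivlMr// mulrC ler_pdivrMr.
Qed.

Lemma mean_oscillation_ge0 f E : (0 <= mean_oscillation mu f E)%E.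
Proof.
by apply: mule_ge0; [rewrite lee_fin invr_ge0 fine_ge0|apply: integral_ge0].
Qed.

Lemma mean_oscillation_le_bmo f S E : S E ->
  (mean_oscillation mu f E <= bmo_norm mu S f)%E.
Proof. by move=> SE; apply: ereal_sup_ubound; exists E. Qed.

Lemma bmo_norm_ge0 f S E : S E -> (0 <= bmo_norm mu S f)%E.
Proof.
by move=> /(mean_oscillation_le_bmo f); apply: le_trans (mean_oscillation_ge0 _ _).
Qed.

Lemma bmo_norm_le f S (M : \bar R) :
  (forall E, S E -> (mean_oscillation mu f E <= M)%E) ->
  (bmo_norm mu S f <= M)%E.
Proof. by move=> h; apply: ge_ereal_sup => _ [E SE <-]; exact: h. Qed.

(** Adding a constant shifts the average by the same constant, and a null set
    does not affect integrals. *)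
Lemma oscillation_ae_const f g E (a : R) : averageable f E ->
  measurable_fun setT f -> measurable_fun setT g ->
  (\forall x \ae mu, g x = f x + a) ->
  mean_oscillation mu g E = mean_oscillation mu f E.
Proof.
move=> aE mf mg gf; have m0 := fine_measure_gt0 aE.
have [mE /andP[_ Eoo] iE] := aE.
have mf' : measurable_fun E f by exact: measurable_funS mf.
have mg' : measurable_fun E g by exact: measurable_funS mg.
have avg : average mu g E = average mu f E + a.
  have -> : average mu g E =
      (fine (mu E))^-1 * \int[mu]_(x in E) (f x + a).
    rewrite /average /Rintegral; congr (_ * fine _).
    apply: ae_eq_integral => //.
    - exact/measurable_EFinP.
    - by apply/measurable_EFinP; apply: measurable_funD.
    - by apply: filterS gf => x + _ /=; move=> ->.
  rewrite RintegralD//; last exact: integrable_constant.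
  by rewrite Rintegral_cst// mulrDr [a * _]mulrC mulKf// gt_eqF.
rewrite /mean_oscillation avg; congr (_ * _)%E.
apply: ae_eq_integral => //.
- by apply/measurable_EFinP/measurableT_comp => //; exact: measurable_funB.
- by apply/measurable_EFinP/measurableT_comp => //; exact: measurable_funB.
- by apply: filterS gf => x + _ /=; move=> ->; rewrite opprD addrACA subrr addr0.
Qed.

End Oscillation.

(** * Consequences of the doubling property *)

Section Geometry.
Context {R : realType} {d : measure_display} {X : measurableType d}.
Variables (rho : X -> X -> R) (mu : {measure set X -> \bar R}).
Hypothesis hdoubling : doubling_measure rho mu.

Lemma subset_qball x (r s : R) : r <= s -> qball rho x r `<=` qball rho x s.
Proof. by move=> rs y /lt_le_trans; apply. Qed.

(** Iterating the doubling property [n] times covers every dilation factor up to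
    [2 ^+ n]; powers of 2 are unbounded. *)
Lemma doubling_dilation (s : R) : 0 < s -> exists2 M : R, 0 < M &
  forall x r, 0 < r -> (mu (qball rho x (s * r)) <= M%:E * mu (qball rho x r))%E.
Proof.
move=> s0; have [mB posB [Cd dblB]] := hdoubling.
(* Raising the doubling constant to at least 1 keeps it one and makes its powers
   positive. *)
pose D : R := Num.max 1 Cd.
have D0 : 0 < D by rewrite lt_max ltr01.
have iterB n x r : 0 < r ->
    (mu (qball rho x (2 ^+ n * r)) <= (D ^+ n)%:E * mu (qball rho x r))%E.
  move=> r0; elim: n => [|n IH]; first by rewrite !expr0 mul1e mul1r.
  rewrite exprS -mulrA; apply: le_trans (dblB _ _ _) _.
    by rewrite mulr_gt0// exprn_gt0.
  rewrite exprS EFinM -muleA; apply: le_trans (_ : _ <= D%:E * _)%E _.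
    by apply: lee_wpmul2r => //; rewrite lee_fin le_max lexx orbT.
  by rewrite lee_pmul2l.
pose n := Num.truncn s.
exists (D ^+ n.+1); first by rewrite exprn_gt0.
move=> x r r0; apply: le_trans (iterB n.+1 x r r0).
apply: le_measure; rewrite ?inE; [| |apply: subset_qball].
- by apply: mB; rewrite mulr_gt0.
- by apply: mB; rewrite mulr_gt0// exprn_gt0.
- rewrite ler_pM2r// (le_trans (ltW (truncnS_gt s)))//.
  by rewrite -natrX ler_nat ltnW// ltn_expl.
Qed.

Lemma qball_averageable f x r : L1loc rho mu f -> 0 < r ->
  averageable mu f (qball rho x r).
Proof. by move: hdoubling => [mB posB _] [_ iB] r0; split; auto. Qed.

End Geometry.

(** * Comparison of the dyadic and the full norms *)

Section DyadicComparison.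
Context {R : realType} {d : measure_display} {X : measurableType d}.
Variables (rho : X -> X -> R) (A0 delta : R).
Variable mu : {measure set X -> \bar R}.
Hypotheses (hrho : quasi_metric rho A0)
  (hborel : borel_sets_measurable rho) (hdoubling : doubling_measure rho mu)
  (hdelta0 : 0 < delta).

Let A0_gt0 : 0 < A0.
Proof. by have [A1 _ _ _ _] := hrho; rewrite (lt_le_trans ltr01). Qed.

Let inner_const_gt0 : 0 < inner_const A0.
Proof. by rewrite invr_gt0 mulr_gt0 ?exprn_gt0. Qed.

Let outer_const_gt0 : 0 < outer_const A0.
Proof. by rewrite mulr_gt0 ?exprn_gt0. Qed.

Lemma dyadic_cube_sandwich D Q : is_dyadic_system rho A0 delta D ->
  dcubes D Q -> measurable Q /\ exists x r, [/\ 0 < r,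
    qball rho x (inner_const A0 * r) `<=` Q &
    Q `<=` qball rho x (outer_const A0 * r)].
Proof.
move=> [bQ _ _ sQ _] [k [a ->]]; split; first exact: (hborel (bQ k a)).
exists (dcenter a), (delta ^ k); have [? ?] := sQ k a.
by split=> //; rewrite exprz_gt0.
Qed.

(** The inner ball makes the measure of a cube positive; the outer ball makes
    it finite and carries the integrability of [f]. *)
Lemma dyadic_cube_averageable D Q f : is_dyadic_system rho A0 delta D ->
  dcubes D Q -> L1loc rho mu f -> averageable mu f Q.
Proof.
move=> dD DQ lf; have [mQ [x [r [r0 iQ oQ]]]] := dyadic_cube_sandwich dD DQ.
have [mB posB _] := hdoubling.
have i0 : 0 < inner_const A0 * r by rewrite mulr_gt0.
have o0 : 0 < outer_const A0 * r by rewrite mulr_gt0.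
apply: (averageableS (qball_averageable hdoubling x lf o0) mQ _ oQ).
have /andP[/lt_le_trans + _] := posB x _ i0; apply.
by apply: le_measure; rewrite ?inE//; apply: mB; rewrite ?mulr_gt0.
Qed.

Lemma dyadic_cube_exists D : is_dyadic_system rho A0 delta D ->
  exists Q, dcubes D Q.
Proof.
move=> [_ _ cov _ _]; have [_ cov0] := cov 0.
have : [set: X] point by [].
by rewrite -cov0 => -[a _ _]; exists (dcube a), 0, a.
Qed.

(** A supremum is nonnegative only over a nonempty family; here the cubes of
    generation 0 cover the inhabited space. *)
Lemma BMOD_norm_ge0 D f : is_dyadic_system rho A0 delta D ->
  (0 <= BMOD_norm mu D f)%E.
Proof. by move=> /dyadic_cube_exists[Q DQ]; exact: bmo_norm_ge0 DQ. Qed.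

(** A cube is compared with its outer ball, whose measure is controlled by that
    of the inner ball.  The ratio of the radii does not depend on the
    generation, which makes the constant uniform. *)
Lemma BMOD_norm_le : exists2 M : R, 0 < M &
  forall D f, is_dyadic_system rho A0 delta D -> L1loc rho mu f ->
  (BMOD_norm mu D f <= M%:E * BMO_norm rho mu f)%E.
Proof.
have [M M0 dil] :=
  doubling_dilation hdoubling (divr_gt0 outer_const_gt0 inner_const_gt0).
exists (2 * M); first by rewrite mulr_gt0.
move=> D f dD lf; apply: bmo_norm_le => Q DQ.
have [mQ [x [r [r0 iQ oQ]]]] := dyadic_cube_sandwich dD DQ.
have [mB _ _] := hdoubling.
have i0 : 0 < inner_const A0 * r by rewrite mulr_gt0.
have o0 : 0 < outer_const A0 * r by rewrite mulr_gt0.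
have [_ /andP[Q0 _] _] := dyadic_cube_averageable dD DQ lf.
have aB := qball_averageable hdoubling x lf o0.
apply: (@le_trans _ _
  ((2 * M)%:E * mean_oscillation mu f (qball rho x (outer_const A0 * r)))%E).
  apply: oscillation_le_super => //.
  have := dil x _ i0; rewrite mulrA divfK ?gt_eqF// => /le_trans; apply.
  rewrite lee_pmul2l ?lte_fin//.
  by apply: le_measure; rewrite ?inE//; apply: mB; rewrite ?mulr_gt0.
rewrite lee_pmul2l ?lte_fin ?mulr_gt0//.
by apply: mean_oscillation_le_bmo; exists x, (outer_const A0 * r).
Qed.

(** The centre of the ball belongs to the cube, so the diameter bound puts the
    cube inside a dilate of the ball. *)
Lemma ball_oscillation_le_cube (c : R) : exists2 M : R, 0 < M &
  forall D f Q x r, is_dyadic_system rho A0 delta D -> L1loc rho mu f ->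
    0 < r -> dcubes D Q -> qball rho x r `<=` Q ->
    (qdiam rho Q <= (c * r)%:E)%E ->
    (mean_oscillation mu f (qball rho x r) <= M%:E * BMOD_norm mu D f)%E.
Proof.
have [_ _ rho0 _ _] := hrho; have [mB posB _] := hdoubling.
(* The factor exceeds [c], since balls are defined by a strict inequality, and
   is positive whatever the sign of [c]. *)
have c0 : 0 < `|c| + 1 by rewrite ltr_wpDl.
have [M M0 dil] := doubling_dilation hdoubling c0.
exists (2 * M); first by rewrite mulr_gt0.
move=> D f Q x r dD lf r0 DQ BQ diamQ.
have aQ := dyadic_cube_averageable dD DQ lf; have [mQ _ _] := aQ.
have Qx : Q x by apply: BQ; rewrite /qball /= (rho0 x x).2.
have QB : Q `<=` qball rho x ((`|c| + 1) * r).
  move=> y Qy; rewrite /qball /=.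
  have : ((rho y x)%:E <= (c * r)%:E)%E.
    by apply: le_trans diamQ; apply: ereal_sup_ubound; exists (y, x).
  rewrite lee_fin => /le_lt_trans; apply.
  by rewrite ltr_pM2r// (le_lt_trans (ler_norm c))// ltrDl.
apply: (@le_trans _ _ ((2 * M)%:E * mean_oscillation mu f Q)%E).
  apply: oscillation_le_super => //; first exact: mB.
    by have /andP[] := posB x r r0.
  apply: le_trans (dil x r r0).
  by apply: le_measure; rewrite ?inE//; apply: mB; rewrite ?mulr_gt0.
by rewrite lee_pmul2l ?lte_fin ?mulr_gt0//; exact: mean_oscillation_le_bmo.
Qed.

Lemma BMO_norm_le_sum (c : R) : exists2 M : R, 0 < M &
  forall (K : nat) (D : 'I_K -> dyadic_system X) f,
    adjacent_dyadic_systems rho A0 delta c D -> L1loc rho mu f ->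
    (BMO_norm rho mu f <= M%:E * \sum_(t < K) BMOD_norm mu (D t) f)%E.
Proof.
have [M M0 hM] := ball_oscillation_le_cube c; exists M => //.
move=> K D f [dD adj] lf; apply: bmo_norm_le => _ [x [r [r0 ->]]].
have [t [Q [DQ BQ diamQ]]] := adj x r r0.
apply: le_trans (hM _ _ _ _ _ (dD t) lf r0 DQ BQ diamQ) _.
rewrite lee_pmul2l ?lte_fin// (bigD1 t)//= leeDl// sume_ge0// => i _.
exact: BMOD_norm_ge0.
Qed.

(** This makes the finiteness of the norm a property of the class, whichever
    representative witnesses it. *)
Lemma BMOD_norm_ae_const D f g (a : R) : is_dyadic_system rho A0 delta D ->
  L1loc rho mu f -> L1loc rho mu g -> (\forall x \ae mu, g x = f x + a) ->
  (BMOD_norm mu D g <= BMOD_norm mu D f)%E.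
Proof.
move=> dD lf lg gf; apply: bmo_norm_le => Q DQ.
have aQ := dyadic_cube_averageable dD DQ lf.
rewrite (oscillation_ae_const aQ lf.1 lg.1 gf).
exact: mean_oscillation_le_bmo.
Qed.

(** Excludes [K = 0], for which the intersection of the dyadic spaces would
    contain every set of functions. *)
Lemma adjacent_systems_nonempty (c : R) (K : nat)
    (D : 'I_K -> dyadic_system X) :
  adjacent_dyadic_systems rho A0 delta c D -> exists t : 'I_K, True.
Proof. by move=> [_ adj]; have [t _] := adj point 1 ltr01; exists t. Qed.

Lemma mod_const_refl f : L1loc rho mu f -> mod_const rho mu f f.
Proof.
move=> lf; split=> //; exists 0; apply: aeW => x; by rewrite addr0.
Qed.

End DyadicComparison.

Theorem proposition7p16
  (R : realType) (d : measure_display) (X : measurableType d)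
  (rho : X -> X -> R) (A0 : R) (hrho : quasi_metric rho A0)
  (mu : {measure set X -> \bar R})
  (hborel : borel_sets_measurable rho) (hdoubling : doubling_measure rho mu)
  (delta : R) (hdelta0 : 0 < delta) (hdelta1 : delta < 1)
  (hdelta : 96%:R * A0 ^+ 6 * delta <= 1) (c : R) :
  exists C C' : R, [/\ 0 < C, 0 < C' &
    forall (K : nat) (D : 'I_K -> dyadic_system X),
      adjacent_dyadic_systems rho A0 delta c D ->
      [/\ forall f : X -> R, L1loc rho mu f ->
            (forall t : 'I_K,
               (C%:E * BMOD_norm mu (D t) f <= BMO_norm rho mu f)%E) /\
            (BMO_norm rho mu f <= C'%:E * \sum_(t < K) BMOD_norm mu (D t) f)%E,
          BMO rho mu = \bigcap_(t in [set: 'I_K]) BMOD rho mu (D t)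
        & exists c1 c2 : R, [/\ 0 < c1, 0 < c2 &
            forall F : set (X -> R), BMO rho mu F ->
            forall f : X -> R, F f ->
              (c1%:E * \sum_(t < K) BMOD_norm mu (D t) f
                 <= BMO_norm rho mu f)%E /\
              (BMO_norm rho mu f
                 <= c2%:E * \sum_(t < K) BMOD_norm mu (D t) f)%E]]].
Proof.
have [M M0 hM] := BMOD_norm_le hrho hborel hdoubling hdelta0.
have [C' C'0 hC'] := BMO_norm_le_sum hrho hborel hdoubling hdelta0 c.
exists M^-1, C'; split; rewrite ?invr_gt0// => K D adj.
have dD := adj.1.
have upper f : L1loc rho mu f ->
    (BMO_norm rho mu f <= C'%:E * \sum_(t < K) BMOD_norm mu (D t) f)%E.
  by move=> lf; exact: hC'.
have lower f t : L1loc rho mu f ->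
    (M^-1%:E * BMOD_norm mu (D t) f <= BMO_norm rho mu f)%E.
  by move=> lf; rewrite lee_pdivrMl//; exact: hM.
have D_ge0 f t : (0 <= BMOD_norm mu (D t) f)%E.
  by exact: BMOD_norm_ge0 (dD t).
split=> [f lf|| ].
- by split=> [t|]; [exact: lower|exact: upper].
- apply/seteqP; split=> [F [f [lf fin] <-] t _|F FD].
    exists f => //; split=> //; apply: le_lt_trans (hM _ _ (dD t) lf) _.
    by rewrite lte_mul_pinfty// lee_fin ltW.
  have [t0 _] := adjacent_systems_nonempty adj.
  (* The representative given by one system serves as the common one. *)
  have [f [lf _] fF] := FD t0 I; exists f => //; split=> //.
  apply: le_lt_trans (upper f lf) _.
  rewrite lte_mul_pinfty ?lee_fin ?ltW//.
  apply: lte_sum_pinfty => t _.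
  have [g [lg finDg] gF] := FD t I.
  have : mod_const rho mu g f by rewrite gF -fF; exact: mod_const_refl.
  move=> [_ [a fg]]; apply: le_lt_trans finDg.
  exact: BMOD_norm_ae_const (dD t) lg lf fg.
(* Each of the [K] terms is at most [M] times the full norm, so their sum is at
   most [M * K.+1] times it. *)
- exists (M^-1 / K.+1%:R), C'; split; rewrite ?divr_gt0 ?invr_gt0//.
  move=> F [g _ <-] f [lf _]; split; last exact: upper.
  have [t0 _] := adjacent_systems_nonempty adj.
  have B0 : (0 <= BMO_norm rho mu f)%E.
    by apply: le_trans (lower f t0 lf); rewrite mule_ge0// lee_fin invr_ge0 ltW.
  rewrite mulrC EFinM -muleA lee_pdivrMl// ge0_sume_distrr//.
  apply: (@le_trans _ _ (\sum_(t < K) BMO_norm rho mu f)%E).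
    by apply: lee_sum => t _; exact: lower.
  rewrite sumr_const card_ord [leLHS](_ : _ = K%:R%:E * BMO_norm rho mu f)%E;
    last by rewrite mule_natl.
  by rewrite lee_wpmul2r// lee_fin ler_nat.
Qed.
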